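(* Let $X\subset\mathbb{R}^s$ be an open convex set, let $C\subset\mathbb{R}^n$ be a closed convex cone with vertex at the origin and with nonempty interior, and let $f:X\to\mathbb{R}^n$ be a Fréchet differentiable vector-valued function which is quasiconvex on $X$ with respect to $C$. Then $f$ is pseudoconvex on $X$ with respect to $C$ if and only if every point $x\in X$ which is a vector critical point of $f$ with respect to $C$ is a weak global minimizer of $f$ with respect to $C$.
   Context: Notation: $a\cdot b$ is the scalar product in Euclidean space, $Jf(x)$ is the ($n\times s$) Jacobian matrix of $f$ at $x$, and for $\lambda\in\mathbb{R}^n$, $\lambda\cdot Jf(x)$ is the vector $\lambda^{T}Jf(x)\in\mathbb{R}^s$. $\mathrm{int}(C)$ is the topological interior of $C$. The positive polar cone of $C$ is $C^*=\{\lambda\in\mathbb{R}^n\mid \lambda\cdot x\ge 0\text{ for all }x\in C\}$. A Fréchet differentiable function $f:X\to\mathbb{R}^n$ is called quasiconvex on $X$ with respect to $C$ iff for all $x,y\in X$: $f(y)\in f(x)-\mathrm{int}(C)$ implies $Jf(x)(y-x)\in -C$. It is called pseudoconvex on $X$ with respect to $C$ iff for all $x,y\in X$: $f(y)\in f(x)-\mathrm{int}(C)$ implies $Jf(x)(y-x)\in-\mathrm{int}(C)$. A point $x\in X$ is a (vector) critical point of $f$ with respect to $C$ iff there exists $\lambda\in C^*$, $\lambda\neq 0$, such that $\lambda\cdot Jf(x)=0$. A point $x\in X$ is a weak global minimizer of $f$ with respect to $C$ iff there is no $y\in X$ such that $f(y)\in f(x)-\mathrm{int}(C)$. *)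

(* Defs.v *)
From mathcomp Require Import all_boot all_order all_algebra.
From mathcomp Require Import classical_sets reals topology normedtype.
From mathcomp Require Import derive convex.

Set Implicit Arguments.
Unset Strict Implicit.
Unset Printing Implicit Defensive.

Import Order.TTheory GRing.Theory Num.Theory numFieldNormedType.Exports.

Local Open Scope classical_set_scope.
Local Open Scope ring_scope.

(* Vectors are rows. The library's ['J f x] acts on rows from the right, so it
   is s x n, with entry (i, j) the i-th partial derivative of f_j; the usual
   Jacobian matrix is its transpose. Maps are total; only their values on X
   matter below when X is open. *)
Definition Jac (R : realType) (s n : nat) (f : 'rV[R]_s -> 'rV[R]_n)
  (x : 'rV[R]_s) : 'M[R]_(n, s) := ('J f x)^T.

(* [(A *m v^T)^T] is the matrix-vector product A v, written as a row. *)
Definition mulmxv (R : realType) (n s : nat) (A : 'M[R]_(n, s))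
  (v : 'rV[R]_s) : 'rV[R]_n := (A *m v^T)^T.

Definition dot (R : realType) (n : nat) (a b : 'rV[R]_n) : R :=
  \sum_(i < n) a 0 i * b 0 i.

Definition cone (R : realType) (n : nat) (C : set 'rV[R]_n) : Prop :=
  forall (t : R) (x : 'rV[R]_n), 0 <= t -> C x -> C (t *: x).

Definition polar (R : realType) (n : nat) (C : set 'rV[R]_n) :
  set 'rV[R]_n := [set l | forall x, C x -> 0 <= dot l x].

Definition quasiconvex (R : realType) (s n : nat) (X : set 'rV[R]_s)
  (C : set 'rV[R]_n) (f : 'rV[R]_s -> 'rV[R]_n) : Prop :=
  forall x y, X x -> X y ->
    [set f x - c | c in interior C] (f y) ->
    [set - c | c in C] (mulmxv (Jac f x) (y - x)).

Definition pseudoconvex (R : realType) (s n : nat) (X : set 'rV[R]_s)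
  (C : set 'rV[R]_n) (f : 'rV[R]_s -> 'rV[R]_n) : Prop :=
  forall x y, X x -> X y ->
    [set f x - c | c in interior C] (f y) ->
    [set - c | c in interior C] (mulmxv (Jac f x) (y - x)).

Definition critical_point (R : realType) (s n : nat) (C : set 'rV[R]_n)
  (f : 'rV[R]_s -> 'rV[R]_n) (x : 'rV[R]_s) : Prop :=
  exists l : 'rV[R]_n, [/\ polar C l, l != 0 & l *m Jac f x = 0].

Definition weak_global_minimizer (R : realType) (s n : nat)
  (X : set 'rV[R]_s) (C : set 'rV[R]_n) (f : 'rV[R]_s -> 'rV[R]_n)
  (x : 'rV[R]_s) : Prop :=
  ~ exists y, X y /\ [set f x - c | c in interior C] (f y).

(* Main.v *)
Require Import Defs.
From mathcomp Require Import all_boot all_order all_algebra.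
From mathcomp Require Import classical_sets reals topology normedtype.
From mathcomp Require Import derive convex.
From mathcomp Require Import boolp interval_inference ring lra.

Set Implicit Arguments.
Unset Strict Implicit.
Unset Printing Implicit Defensive.

Import Order.TTheory GRing.Theory Num.Theory numFieldNormedType.Exports.

Local Open Scope classical_set_scope.
Local Open Scope ring_scope.

(** Fix [x] and [y] with [f y] in [f x - int C], and write [J] for the
    derivative of [f] at [x].

    From pseudoconvexity to minimality: a nonzero element of the polar cone is
    strictly positive on [int C] ([polar_interior_gt0]), so it cannot annihilate
    [J (y - x)], which lies in [- int C]; hence [x] is not critical.

    Conversely, if critical points are weak minimizers then [x] is not
    critical, and the alternative of Gordan type [gordan_alternative] produces a
    direction [v] with [J v] in [int C]. By continuity the point
    [y + r v] still has its value in [f x - int C] when [r > 0] is small, so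
    quasiconvexity gives [J (y + r v - x)] in [- C], that is,
    [J (y - x) = - (c + r J v)] with [c] in [C]. Since [C + int C] is contained
    in [int C], the vector [J (y - x)] is in [- int C]. Thus the strictly feasible
    direction [v] upgrades the weak conclusion to the strict one.

    The alternative comes from a finite-dimensional form of M. Riesz's extension
    theorem ([riesz_cone_functional]), applied to the cone [C + im J] and the
    functional [t *: e |-> t] on the line of a point [e] of [int C]. The proof is
    algebraic: the cone is enlarged by one line for each vector [b] of the
    canonical basis, directed by some [b - t *: e] and chosen so that [- e] stays
    outside. These lines span the kernel of the functional that is sought, and
    the numbers [t] are its coordinates. *)

(** * M. Riesz extension of a functional on a line *)

Section Separation.
Variables (R : realType) (n : nat).
Implicit Types (C D : set 'rV[R]_n) (b e l v x y z : 'rV[R]_n).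

Lemma dotE l x : dot l x = (l *m x^T) 0 0.
Proof. by rewrite mxE; apply: eq_bigr => i _; rewrite mxE. Qed.

Lemma dotDr l x y : dot l (x + y) = dot l x + dot l y.
Proof. by rewrite !dotE linearD mulmxDr mxE. Qed.

Lemma dotZr l (t : R) x : dot l (t *: x) = t * dot l x.
Proof. by rewrite !dotE linearZ /= -scalemxAr mxE. Qed.

Lemma dotNr l x : dot l (- x) = - dot l x.
Proof. by rewrite -scaleN1r dotZr mulN1r. Qed.

Lemma dot_gt0 l : l != 0 -> 0 < dot l l.
Proof.
move=> l0; have sq_ge0 i : 0 <= l 0 i * l 0 i by rewrite -expr2 sqr_ge0.
rewrite lt0r sumr_ge0 // andbT; apply: contra l0.
rewrite psumr_eq0 // => /allP l0; apply/eqP/rowP => i; rewrite mxE.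
by have := l0 i (mem_index_enum i); rewrite -expr2 sqrf_eq0 => /eqP.
Qed.

Lemma row_dot_eq0 l : (forall v, dot l v = 0) -> l = 0.
Proof. by move=> l0; apply/eqP; apply: contraT => /dot_gt0; rewrite l0 ltxx. Qed.

(** The hypotheses of M. Riesz's extension theorem for the functional
    [t *: e |-> t]: the third clause says that the convex cone [D] and the line
    of [e] together generate the space, the fourth one that this functional is
    nonnegative on the part of the line that lies in [D]. *)
Definition riesz_cone e D :=
  [/\ cone D, forall x y, D x -> D y -> D (x + y),
      forall v, exists t : R, D (t *: e - v) & ~ D (- e)].

Lemma riesz_cone_ge0 e D (r : R) :
  riesz_cone e D -> D (r *: e) -> 0 <= r.
Proof.
move=> [Dc _ _ De] Dre; rewrite leNgt; apply/negP => r0; apply: De.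
have -> : - e = (- r^-1) *: (r *: e).
  by rewrite scalerA mulNr mulVf ?scaleN1r ?lt_eqF.
by apply: Dc Dre; rewrite oppr_ge0 invr_le0 ltW.
Qed.

(** A line directed by [b - t *: e] can be added to the cone without reaching
    [- e] when [t] is the gauge of [b], the infimum of the [s] such that
    [s *: e - b] is in the cone. Indeed, if [- e = d + a *: (b - t *: e)] with
    [d] in the cone, then for [a > 0] the value [t - a^-1] would belong to the
    set of which [t] is the infimum, while for [a < 0] some [s] of that set below
    [t - a^-1] would put a negative multiple of [e] in the cone. *)
Lemma riesz_cone_add_line e D b : riesz_cone e D ->
  exists (t : R) D', [/\ riesz_cone e D', D `<=` D',
    D' (b - t *: e) & D' (t *: e - b)].
Proof.
move=> De; have ge0 := riesz_cone_ge0 De; case: (De) => Dc Dadd Du Dne.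
have D0 : D 0 by have [t /(Dc 0)] := Du 0; rewrite scale0r; apply.
pose S : set R := [set s | D (s *: e - b)].
have Sne : S !=set0 by have [s Ds] := Du b; exists s.
have Slb : has_lbound S.
  have [r Dr] := Du (- b); exists (- r) => s Ss.
  have : D ((r + s) *: e).
    have -> : (r + s) *: e = (r *: e - - b) + (s *: e - b).
      by rewrite opprK addrACA subrr addr0 scalerDl.
    exact: Dadd.
  by move=> /ge0; lra.
pose t := inf S; pose w := b - t *: e.
exists t, [set z | exists d a, D d /\ z = d + a *: w]; split.
- split.
  + move=> r _ r0 [d [a [Dd ->]]]; exists (r *: d), (r * a).
    by split; [exact: Dc | rewrite scalerDr scalerA].
  + move=> _ _ [d [a [Dd ->]]] [d' [a' [Dd' ->]]].
    exists (d + d'), (a + a'); split; first exact: Dadd.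
    by rewrite scalerDl addrACA.
  + move=> v; have [r Dr] := Du v; exists r, (r *: e - v), 0.
    by rewrite scale0r addr0.
  + move=> [d [a [Dd eq_e]]].
    have [a0|a0|a0] := ltgtP a 0.
    * have a1 : 0 < - a^-1 by rewrite oppr_gt0 invr_lt0.
      have [s Ss st] := inf_adherent a1 (conj Sne Slb).
      have : D ((s - t + a^-1) *: e).
        have -> : (s - t + a^-1) *: e = (s *: e - b) + (- a^-1) *: d.
          have -> : d = - e - a *: w by rewrite eq_e addrK.
          by apply/rowP => i; rewrite !mxE; field; rewrite lt_eqF.
        by apply: Dadd => //; apply: Dc Dd; rewrite oppr_ge0 invr_le0 ltW.
      by move=> /ge0; move: st; rewrite -/t; lra.
    * have : S (t - a^-1).
        have -> : S (t - a^-1) = D (a^-1 *: d).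
          have -> : d = - e - a *: w by rewrite eq_e addrK.
          congr D; apply/rowP => i; rewrite !mxE; field.
          by rewrite gt_eqF.
        by apply: Dc Dd; rewrite invr_ge0 ltW.
      move=> /(ge_inf Slb); rewrite -/t => h.
      have : 0 < a^-1 by rewrite invr_gt0.
      by lra.
    * by apply: Dne; rewrite eq_e a0 scale0r addr0.
- by move=> d Dd; exists d, 0; rewrite scale0r addr0.
- by exists 0, 1; rewrite scale1r add0r.
- by exists 0, (-1); rewrite scaleN1r add0r opprB.
Qed.

Lemma riesz_cone_add_lines e D (bs : seq 'rV[R]_n) :
  riesz_cone e D ->
  exists D', [/\ riesz_cone e D', D `<=` D' &
    forall b, b \in bs -> exists t : R, D' (b - t *: e) /\ D' (t *: e - b)].
Proof.
elim: bs D => [|b bs IH] D De; first by exists D; split.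
have [t [D1 [D1e DD1 D1b D1b']]] := riesz_cone_add_line b De.
have [D' [D'e D1D' D'bs]] := IH _ D1e; exists D'; split => //.
  exact: subset_trans DD1 D1D'.
move=> c; rewrite inE => /predU1P[->|/D'bs//].
by exists t; split; exact: D1D'.
Qed.

(** In an enlarged cone [D'] containing both [delta_i - t_i *: e] and its
    opposite for all [i], every [v] equals [dot l v *: e] modulo the lineality
    space, where [l] has coordinates [t_i]. So [v] in [D'] forces
    [dot l v *: e] in [D'], that is, [0 <= dot l v]. *)
Lemma riesz_cone_functional e D : riesz_cone e D ->
  exists l, polar D l /\ dot l e != 0.
Proof.
move=> De.
have [D' [D'e DD' D'b]] :=
  riesz_cone_add_lines [seq delta_mx 0 i | i : 'I_n] De.
have /choice [t D't] (i : 'I_n) : exists t : R,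
  D' (delta_mx 0 i - t *: e) /\ D' (t *: e - delta_mx 0 i).
  by apply: D'b; apply/mapP; exists i => //; rewrite mem_enum.
pose l : 'rV[R]_n := \row_i t i.
case: (D'e) => D'c D'add D'u D'ne.
have D'0 : D' 0 by have [r /(D'c 0)] := D'u 0; rewrite scale0r; apply.
have shift v : D' (dot l v *: e - v).
  have -> : dot l v *: e - v = \sum_i v 0 i *: (t i *: e - delta_mx 0 i).
    under [RHS]eq_bigr do rewrite scalerBr scalerA.
    rewrite sumrB -row_sum_delta -scaler_suml /dot.
    by congr (_ *: _ - _); apply: eq_bigr => i _; rewrite mxE mulrC.
  apply: (big_ind D') => // i _; have [Dp Dm] := D't i.
  have [v0|v0] := leP 0 (v 0 i); first exact: D'c.
  rewrite -opprB scalerN -scaleNr.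
  by apply: D'c => //; rewrite oppr_ge0 ltW.
exists l; split.
  move=> x /DD' D'x; apply: (riesz_cone_ge0 D'e).
  by rewrite -[_ *: e](subrK x); exact: D'add.
apply/eqP => le0; apply: D'ne.
by have := shift e; rewrite le0 scale0r sub0r.
Qed.

End Separation.

(** * Interior and polar of a convex cone *)

Lemma nbhs_scaled_step (R : realType) (m : nat) (U : set 'rV[R]_m)
    (x v : 'rV[R]_m) :
  nbhs x U -> exists2 r : R, 0 < r & U (x + r *: v).
Proof.
move=> Ux.
have cvg : (fun r : R => x + r *: v) @ 0^'+ --> x.
  rewrite -[X in _ --> X]addr0 -(scale0r v).
  apply: cvgD; first exact: cvg_cst.
  exact/cvg_at_right_filter/scalel_continuous.
have : \forall r \near 0^'+, 0 < r /\ U (x + r *: v).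
  by near=> r; split; near: r; [exact: nbhs_right_gt | exact: cvg].
by move=> /filter_ex [r [r0 Ur]]; exists r.
Unshelve. all: by end_near. Qed.

Section InteriorOfCone.
Variables (R : realType) (n : nat) (C : set 'rV[R]_n).
Hypothesis C_cone : cone C.
Implicit Types (c e l v x y : 'rV[R]_n).

(** The sum is twice the midpoint. *)
Lemma convex_cone_add x y : convex_set C -> C x -> C y -> C (x + y).
Proof.
move=> Cconv Cx Cy.
have h0 : 0 <= 2^-1 :> R by lra.
have h1 : 2^-1 <= 1 :> R by lra.
have /set_mem Cmid := Cconv x y (Itv01 h0 h1) (mem_set Cx) (mem_set Cy).
have := C_cone (ler0n R 2) Cmid.
congr C; apply/rowP => i; rewrite !mxE /= /unstable.onem.
by field.
Qed.

(** A point [e + r *: - v] with [r > 0] small stays in [C]; rescale it by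
    [r^-1]. *)
Lemma interior_generates e v : interior C e -> exists t : R, C (t *: e - v).
Proof.
move=> /(nbhs_scaled_step (- v)) [r r0 Cr]; exists r^-1.
have -> : r^-1 *: e - v = r^-1 *: (e + r *: - v).
  by rewrite scalerDr scalerA mulVf ?gt_eqF // scale1r.
by apply: C_cone Cr; rewrite invr_ge0 ltW.
Qed.

(** Some [t *: e - l] is in [C], so that [t * dot l e >= dot l l > 0], which
    excludes [dot l e = 0]. *)
Lemma polar_interior_gt0 l e :
  polar C l -> l != 0 -> interior C e -> 0 < dot l e.
Proof.
move=> lC l0 Ce; have [t /lC] := interior_generates l Ce.
rewrite dotDr dotNr dotZr => lt; have le := lC _ (interior_subset Ce).
rewrite lt0r le andbT; apply: contraTneq lt => ->.
by rewrite mulr0 sub0r oppr_ge0 -ltNge dot_gt0.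
Qed.

Lemma interior_scale (r : R) e : 0 < r -> interior C e -> interior C (r *: e).
Proof.
move=> r0 Ce.
have unscale_near : \forall z \near r *: e, C (r^-1 *: z).
  apply: (@scaler_continuous _ _ r^-1 (r *: e)).
  by rewrite scalerA mulVf ?gt_eqF // scale1r.
apply: filterS unscale_near => z /(C_cone (ltW r0)).
by rewrite scalerA mulfV ?scale1r // gt_eqF.
Qed.

Lemma interior_add c e : convex_set C ->
  C c -> interior C e -> interior C (c + e).
Proof.
move=> Cconv Cc Ce.
have sub_near : \forall z \near c + e, C (z - c).
  apply: (cvgB cvg_id (cvg_cst c)).
  by rewrite addrAC subrr add0r.
apply: filterS sub_near => z /(convex_cone_add Cconv Cc).
by rewrite addrC subrK.
Qed.

(** If the row space of [A] misses [int C], the cone [D := C + im A] does not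
    contain [- e] for [e] in [int C]: otherwise [c + e] would be in that row
    space for some [c] in [C], whereas [C + int C] lies in [int C]. A
    functional nonnegative on [D] is in the polar of [C], and vanishes on [im A]
    because this is a linear subspace of [D]. *)
Lemma gordan_alternative (s : nat) (A : 'M[R]_(s, n)) :
  convex_set C -> interior C !=set0 ->
  (exists v : 'rV[R]_s, interior C (v *m A)) \/
  (exists l, [/\ polar C l, l != 0 & l *m A^T = 0]).
Proof.
move=> Cconv [e Ce]; have Cadd := fun x y => @convex_cone_add x y Cconv.
have [[v Cv]|noC] := pselect (exists v : 'rV[R]_s, interior C (v *m A)).
  by left; exists v.
right; pose D : set 'rV[R]_n :=
  [set z | exists c (v : 'rV[R]_s), C c /\ z = c + v *m A].
have C0 : C 0 by rewrite -(scale0r e); apply: C_cone (interior_subset Ce).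
have CD c : C c -> D c by move=> Cc; exists c, 0; rewrite mul0mx addr0.
have De : riesz_cone e D.
  split.
  - move=> r _ r0 [c [v [Cc ->]]]; exists (r *: c), (r *: v).
    by rewrite scalerDr scalemxAl; split => //; exact: C_cone.
  - move=> _ _ [c [v [Cc ->]]] [c' [v' [Cc' ->]]]; exists (c + c'), (v + v').
    by rewrite mulmxDl addrACA; split => //; exact: Cadd.
  - by move=> v; have [t Ct] := interior_generates v Ce; exists t; exact: CD.
  - move=> [c [v [Cc eq_e]]]; apply: noC; exists (- v).
    have -> : - v *m A = c + e.
      by rewrite mulNmx -[e]opprK eq_e opprD addrA subrr add0r.
    exact: interior_add.
have [l [lD le]] := riesz_cone_functional De.
exists l; split; first by move=> c /CD /lD.
  apply: contra_neq le => ->.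
  by rewrite dotE mul0mx mxE.
apply: row_dot_eq0 => v.
have -> : dot (l *m A^T) v = dot l (v *m A).
  by rewrite !dotE trmx_mul mulmxA.
have lvA w : 0 <= dot l (w *m A) by apply: lD; exists 0, w; rewrite add0r.
apply/eqP; rewrite eq_le lvA andbT.
by have := lvA (- v); rewrite mulNmx dotNr oppr_ge0.
Qed.

End InteriorOfCone.

Theorem theorem1 (R : realType) (s n : nat)
    (X : set 'rV[R]_s) (X_open : open X) (X_convex : convex_set X)
    (C : set 'rV[R]_n) (C_closed : closed C) (C_convex : convex_set C)
    (C_cone : cone C) (C_int : interior C !=set0)
    (f : 'rV[R]_s -> 'rV[R]_n)
    (f_diff : forall x, X x -> differentiable f x)
    (f_quasi : quasiconvex X C f) :
  pseudoconvex X C f <->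
  (forall x, X x -> critical_point C f x -> weak_global_minimizer X C f x).
Proof.
have JacE x v : mulmxv (Jac f x) v = v *m 'J f x.
  by rewrite /mulmxv /Jac trmx_mul !trmxK.
split=> [f_pseudo x Xx [l [lC l0 lJ]] [y [Xy fy]]|crit_min x y Xx Xy fy].
  have [c Cc eq_c] := f_pseudo x y Xx Xy fy.
  have := polar_interior_gt0 C_cone lC l0 Cc.
  rewrite -[c]opprK eq_c dotNr dotE /mulmxv trmxK mulmxA lJ mul0mx mxE.
  by rewrite oppr0 ltxx.
have [[v Cv]|[l lcrit]] :=
    gordan_alternative C_cone ('J f x) C_convex C_int; last first.
  by case: (crit_min x Xx _); [exists l | exists y].
have near_y : \forall z \near y, X z /\ interior C (f x - f z).
  have [c Cc eq_c] := fy.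
  have Cfy : nbhs (f x - f y) (interior C).
    by apply: open_nbhs_nbhs; split; [exact: open_interior | rewrite -eq_c subKr].
  near=> z; split; near: z; first exact: open_nbhs_nbhs.
  apply: (cvgB (cvg_cst _) (differentiable_continuous (f_diff y Xy))).
  exact: Cfy.
have [r r0 [Xz Cz]] := nbhs_scaled_step v near_y.
have [c Cc eq_c] : [set - c | c in C] (mulmxv (Jac f x) (y + r *: v - x)).
  by apply: f_quasi => //; exists (f x - f (y + r *: v)); rewrite ?subKr.
exists (c + r *: (v *m 'J f x)).
  by apply: interior_add => //; exact: interior_scale.
rewrite JacE in eq_c *; rewrite opprD eq_c addrAC mulmxDl -scalemxAl.
by rewrite addrK.
Unshelve. all: by end_near. Qed.
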